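(* The $D_4^{(1)}$ system (defined in the context) has the following ''first integral'', i.e. along the system one has the closed equation $$\frac{d(x-y)}{dt}=\frac{b(t)}{2\eta}(x-y)(x-y+1)(x-y+1-\eta)(x-y-\eta).$$
   Context: The $D_4^{(1)}$ system. Let $\eta\in\mathbb{C}\setminus\{0\}$, let $b(t)\in\mathbb{C}(t)$ be nonzero, and let $\alpha_0,\dots,\alpha_4\in\mathbb{C}$ satisfy $\alpha_0+\alpha_1+2\alpha_2+\alpha_3+\alpha_4=1$. The $D_4^{(1)}$ system for unknown functions $x,y,z$ of $t$ is $$\frac{2\eta}{b(t)}\frac{dx}{dt}=P,\qquad -\frac{2\eta}{b(t)}\frac{dy}{dt}=Q,\qquad \frac{2\eta}{b(t)}\frac{dz}{dt}=R,$$ where $P=-2x(y-1)yz(x-\eta)(2x-2y+1-\eta)-2(2\alpha_0+2\alpha_1+4\alpha_2+\alpha_3+\alpha_4)x^3y-2(\alpha_0+\alpha_1)xy^3+(5\alpha_0+5\alpha_1+6\alpha_2+\alpha_3+\alpha_4)x^2y^2-\{5\alpha_0+5\alpha_1+6\alpha_2+2\alpha_3-3(2\alpha_0+2\alpha_1+4\alpha_2+\alpha_3+\alpha_4)\eta\}x^2y+\{3(\alpha_0+\alpha_1)-(4\alpha_0+6\alpha_1+6\alpha_2+\alpha_3+\alpha_4)\eta\}xy^2+x^4+2(\alpha_0+\alpha_1+2\alpha_2+\alpha_3-\eta)x^3+2\alpha_1\eta y^3+\{(\alpha_0+\alpha_1+2\alpha_2+\alpha_3)(\eta^2-3\eta+1)+\alpha_4\eta^2\}x^2+\alpha_1(\eta-3)\eta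 y^2+\{-(\alpha_0+\alpha_1)+2(2\alpha_0+3\alpha_1+3\alpha_2+\alpha_3)\eta-(2\alpha_0+2\alpha_1+4\alpha_2+\alpha_3+\alpha_4)\eta^2\}xy+(\alpha_0+\alpha_1+2\alpha_2+\alpha_3)(\eta-1)\eta x-\alpha_1(\eta-1)\eta y$, $Q=2x(y-1)yz(x-\eta)(2x-2y+1-\eta)-2(\alpha_3+\alpha_4)x^3y-2(\alpha_0+\alpha_1+4\alpha_2+2\alpha_3+2\alpha_4)xy^3+(\alpha_0+\alpha_1+6\alpha_2+5\alpha_3+5\alpha_4)x^2y^2+\{-(\alpha_0+\alpha_1+6\alpha_2+4\alpha_3+6\alpha_4)+3(\alpha_3+\alpha_4)\eta\}x^2y+\{3(\alpha_0+\alpha_1+4\alpha_2+2\alpha_3+2\alpha_4)-(2\alpha_0+6\alpha_2+5\alpha_3+5\alpha_4)\eta\}xy^2+y^4+2\alpha_4x^3+2\{(\alpha_0+2\alpha_2+\alpha_3+\alpha_4)\eta-1\}y^3-\alpha_4(3\eta-1)x^2+\{1-3(\alpha_0+2\alpha_2+\alpha_3+\alpha_4)\eta+(\alpha_0+2\alpha_2+\alpha_3+\alpha_4)\eta^2\}y^2+\{-(\alpha_0+\alpha_1+4\alpha_2+2\alpha_3+2\alpha_4)+2(\alpha_0+3\alpha_2+2\alpha_3+3\alpha_4)\eta-(\alpha_3+\alpha_4)\eta^2\}xy+\alpha_4(\eta-1)\eta x-(\alpha_0+2\alpha_2+\alpha_3+\alpha_4)(\eta-1)\eta y$, $R=(2x-2y+1-\eta)\{2x^2y+2xy^2-x^2-\eta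 y^2-2(\eta+1)xy+\eta(x+y)\}z^2+z\big[-2(\alpha_3+\alpha_4)x^3+2(\alpha_0+\alpha_1)y^3+2(\alpha_0+\alpha_1+6\alpha_2+2\alpha_3+2\alpha_4)x^2y-2(2\alpha_0+2\alpha_1+6\alpha_2+\alpha_3+\alpha_4)xy^2+\{-(\alpha_0+\alpha_1+6\alpha_2+4\alpha_3)+3(\alpha_3+\alpha_4)\eta\}x^2+\{-3(\alpha_0+\alpha_1)+(4\alpha_0+6\alpha_2+\alpha_3+\alpha_4)\eta\}y^2-4\{-(\alpha_0+\alpha_1+3\alpha_2+\alpha_3)+(\alpha_0+3\alpha_2+\alpha_3+\alpha_4)\eta\}xy+\{-(\alpha_0+\alpha_1+4\alpha_2+2\alpha_3)+2(\alpha_0+3\alpha_2+2\alpha_3)\eta-(\alpha_3+\alpha_4)\eta^2\}x+\{\alpha_0+\alpha_1-2(2\alpha_0+3\alpha_2+\alpha_3)\eta+(2\alpha_0+4\alpha_2+\alpha_3+\alpha_4)\eta^2\}y-(\alpha_0+2\alpha_2+\alpha_3)(\eta-1)\eta\big]+\alpha_2\big[(\alpha_0+\alpha_1+2\alpha_2-\alpha_3-\alpha_4)x^2+(\alpha_0+\alpha_1-2\alpha_2-\alpha_3-\alpha_4)y^2-2(\alpha_0+\alpha_1-\alpha_3-\alpha_4)xy+\{\alpha_0+\alpha_1-2\alpha_3-(2\alpha_0+2\alpha_2-\alpha_3-\alpha_4)\eta\}x+\{-\alpha_0-\alpha_1+2\alpha_2+2\alpha_3+(2\alpha_0-\alpha_3-\alpha_4)\eta\}y+(\eta-1)(\alpha_2+\alpha_3+(\alpha_0+\alpha_2)\eta)\big]$.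 *)

(* Defs.v *)
From mathcomp Require Import all_boot all_order all_algebra generic_quotient.
From mathcomp Require Import all_classical all_reals all_analysis.
From mathcomp Require Import complex.

Set Implicit Arguments.
Unset Strict Implicit.
Unset Printing Implicit Defensive.

Import Order.TTheory GRing.Theory Num.Theory.
Import numFieldNormedType.Exports.

Local Open Scope classical_set_scope.
Local Open Scope quotient_scope.
Local Open Scope ring_scope.

(* Typed as a [numClosedFieldType] so that the normed-module structure (and
   hence [open], [derivable], [derive1]) that MathComp-Analysis attaches to
   every [numFieldType] is found; [derivable f t 1] is then complex
   differentiability of [f] at [t]. *)
Definition Cplx (R : realType) : numClosedFieldType := R[i].

(* Evaluation of a rational function goes through its lowest-terms form, since
   the representative [repr b] need not be reduced. *)
Section RationalFunctions.
Variable F : fieldType.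
Implicit Type b : {fraction {poly F}}.

Definition ratfun_num b : {poly F} :=
  (val (repr b)).1 %/ gcdp (val (repr b)).1 (val (repr b)).2.

Definition ratfun_den b : {poly F} :=
  (val (repr b)).2 %/ gcdp (val (repr b)).1 (val (repr b)).2.

Definition ratfun_pole b (t : F) : bool := root (ratfun_den b) t.

Definition ratfun_eval b (t : F) : F := (ratfun_num b).[t] / (ratfun_den b).[t].

Lemma ratfun_den_neq0 b : ratfun_den b != 0.
Proof.
by rewrite /ratfun_den dvdp_div_eq0 ?dvdp_gcdr ?denom_ratioP.
Qed.

Lemma ratfun_coprime b : coprimep (ratfun_num b) (ratfun_den b).
Proof.
apply: coprimep_div_gcd; apply/orP; right.
exact: denom_ratioP.
Qed.

Lemma ratfunE b :
  b = FracField.tofrac (ratfun_num b) / FracField.tofrac (ratfun_den b).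
Proof.
have d0 : (val (repr b)).2 != 0 by exact: denom_ratioP.
have g0 : gcdp (val (repr b)).1 (val (repr b)).2 != 0.
  by rewrite gcdp_eq0 negb_and d0 orbT.
have bE : b = FracField.tofrac (val (repr b)).1
              / FracField.tofrac (val (repr b)).2.
  rewrite -[LHS]reprK -[RHS]/(FracField.mul _ (FracField.inv _)) !piE.
  rewrite /FracField.invf /FracField.mulf !numden_Ratio ?oner_neq0 //.
  by rewrite mulr1 mul1r Ratio_numden.
have nE := divpK (dvdp_gcdl (val (repr b)).1 (val (repr b)).2).
have dE := divpK (dvdp_gcdr (val (repr b)).1 (val (repr b)).2).
rewrite [LHS]bE -[X in FracField.tofrac X / _]nE.
rewrite -[X in _ / FracField.tofrac X]dE !tofracM invfM mulrACA mulfV ?mulr1 //.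
by rewrite tofrac_eq0.
Qed.

End RationalFunctions.

Section D4System.

Section RightHandSides.
Variable K : comNzRingType.
Variables (eta a0 a1 a2 a3 a4 : K).
Implicit Types x y z : K.

Definition D4_P x y z : K :=
  - 2 * x * (y - 1) * y * z * (x - eta) * (2 * x - 2 * y + 1 - eta)
  - 2 * (2 * a0 + 2 * a1 + 4 * a2 + a3 + a4) * x ^+ 3 * y
  - 2 * (a0 + a1) * x * y ^+ 3
  + (5 * a0 + 5 * a1 + 6 * a2 + a3 + a4) * x ^+ 2 * y ^+ 2
  - (5 * a0 + 5 * a1 + 6 * a2 + 2 * a3
     - 3 * (2 * a0 + 2 * a1 + 4 * a2 + a3 + a4) * eta) * x ^+ 2 * y
  + (3 * (a0 + a1) - (4 * a0 + 6 * a1 + 6 * a2 + a3 + a4) * eta) * x * y ^+ 2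
  + x ^+ 4
  + 2 * (a0 + a1 + 2 * a2 + a3 - eta) * x ^+ 3
  + 2 * a1 * eta * y ^+ 3
  + ((a0 + a1 + 2 * a2 + a3) * (eta ^+ 2 - 3 * eta + 1)
     + a4 * eta ^+ 2) * x ^+ 2
  + a1 * (eta - 3) * eta * y ^+ 2
  + (- (a0 + a1) + 2 * (2 * a0 + 3 * a1 + 3 * a2 + a3) * eta
     - (2 * a0 + 2 * a1 + 4 * a2 + a3 + a4) * eta ^+ 2) * x * y
  + (a0 + a1 + 2 * a2 + a3) * (eta - 1) * eta * x
  - a1 * (eta - 1) * eta * y.

Definition D4_Q x y z : K :=
  2 * x * (y - 1) * y * z * (x - eta) * (2 * x - 2 * y + 1 - eta)
  - 2 * (a3 + a4) * x ^+ 3 * y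
  - 2 * (a0 + a1 + 4 * a2 + 2 * a3 + 2 * a4) * x * y ^+ 3
  + (a0 + a1 + 6 * a2 + 5 * a3 + 5 * a4) * x ^+ 2 * y ^+ 2
  + (- (a0 + a1 + 6 * a2 + 4 * a3 + 6 * a4)
     + 3 * (a3 + a4) * eta) * x ^+ 2 * y
  + (3 * (a0 + a1 + 4 * a2 + 2 * a3 + 2 * a4)
     - (2 * a0 + 6 * a2 + 5 * a3 + 5 * a4) * eta) * x * y ^+ 2
  + y ^+ 4
  + 2 * a4 * x ^+ 3
  + 2 * ((a0 + 2 * a2 + a3 + a4) * eta - 1) * y ^+ 3
  - a4 * (3 * eta - 1) * x ^+ 2
  + (1 - 3 * (a0 + 2 * a2 + a3 + a4) * eta
     + (a0 + 2 * a2 + a3 + a4) * eta ^+ 2) * y ^+ 2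
  + (- (a0 + a1 + 4 * a2 + 2 * a3 + 2 * a4)
     + 2 * (a0 + 3 * a2 + 2 * a3 + 3 * a4) * eta
     - (a3 + a4) * eta ^+ 2) * x * y
  + a4 * (eta - 1) * eta * x
  - (a0 + 2 * a2 + a3 + a4) * (eta - 1) * eta * y.

Definition D4_R x y z : K :=
  (2 * x - 2 * y + 1 - eta)
    * (2 * x ^+ 2 * y + 2 * x * y ^+ 2 - x ^+ 2 - eta * y ^+ 2
       - 2 * (eta + 1) * x * y + eta * (x + y)) * z ^+ 2
  + z * (- 2 * (a3 + a4) * x ^+ 3
         + 2 * (a0 + a1) * y ^+ 3
         + 2 * (a0 + a1 + 6 * a2 + 2 * a3 + 2 * a4) * x ^+ 2 * y
         - 2 * (2 * a0 + 2 * a1 + 6 * a2 + a3 + a4) * x * y ^+ 2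
         + (- (a0 + a1 + 6 * a2 + 4 * a3) + 3 * (a3 + a4) * eta) * x ^+ 2
         + (- 3 * (a0 + a1) + (4 * a0 + 6 * a2 + a3 + a4) * eta) * y ^+ 2
         - 4 * (- (a0 + a1 + 3 * a2 + a3)
                + (a0 + 3 * a2 + a3 + a4) * eta) * x * y
         + (- (a0 + a1 + 4 * a2 + 2 * a3)
            + 2 * (a0 + 3 * a2 + 2 * a3) * eta
            - (a3 + a4) * eta ^+ 2) * x
         + (a0 + a1 - 2 * (2 * a0 + 3 * a2 + a3) * eta
            + (2 * a0 + 4 * a2 + a3 + a4) * eta ^+ 2) * y
         - (a0 + 2 * a2 + a3) * (eta - 1) * eta)
  + a2 * ((a0 + a1 + 2 * a2 - a3 - a4) * x ^+ 2
          + (a0 + a1 - 2 * a2 - a3 - a4) * y ^+ 2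
          - 2 * (a0 + a1 - a3 - a4) * x * y
          + (a0 + a1 - 2 * a3 - (2 * a0 + 2 * a2 - a3 - a4) * eta) * x
          + (- a0 - a1 + 2 * a2 + 2 * a3 + (2 * a0 - a3 - a4) * eta) * y
          + (eta - 1) * (a2 + a3 + (a0 + a2) * eta)).

End RightHandSides.

Variable R : realType.
Local Notation C := (Cplx R).

(* [U] is the open set of the t-plane on which the solution lives; a solution
   with singularities is covered by removing them from [U].  The factor
   2 eta / b(t) is meaningless (in Rocq: zero) at a zero of [b], so the
   equations are imposed only where b(t) is nonzero. *)
Record D4_solution (eta : C) (b : {fraction {poly C}}) (a0 a1 a2 a3 a4 : C)
    (U : set C) (x y z : C -> C) : Prop := {
  D4_open : open U;
  D4_no_pole : forall t, U t -> ~~ ratfun_pole b t;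
  D4_derivable_x : forall t, U t -> derivable x t 1;
  D4_derivable_y : forall t, U t -> derivable y t 1;
  D4_derivable_z : forall t, U t -> derivable z t 1;
  D4_eq_x : forall t, U t -> ratfun_eval b t != 0 ->
    2 * eta / ratfun_eval b t * derive1 x t
      = D4_P eta a0 a1 a2 a3 a4 (x t) (y t) (z t);
  D4_eq_y : forall t, U t -> ratfun_eval b t != 0 ->
    - (2 * eta / ratfun_eval b t) * derive1 y t
      = D4_Q eta a0 a1 a2 a3 a4 (x t) (y t) (z t);
  D4_eq_z : forall t, U t -> ratfun_eval b t != 0 ->
    2 * eta / ratfun_eval b t * derive1 z t
      = D4_R eta a0 a1 a2 a3 a4 (x t) (y t) (z t)
}.

End D4System.

(* Main.v *)
Require Import Defs.
From mathcomp Require Import all_boot all_order all_algebra.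
From mathcomp Require Import all_classical all_reals all_analysis.
From mathcomp Require Import complex ring lra.
Import Order.TTheory GRing.Theory Num.Theory.
Import numFieldNormedType.Exports.
Local Open Scope classical_set_scope.
Local Open Scope ring_scope.

(** Adding the equations for [x] and [y] gives
    (2 eta / b) (x' - y') = P + Q, and under the normalization of the
    parameters P + Q collapses to the quartic of the claim: the terms in [z]
    are opposite, and what remains depends on x and y only through x - y
    ([D4_PQ]).  This settles the claim at every point where [b] is nonzero.

    At a zero t of [b] the system says nothing, and the claim is that x' - y'
    takes there the value that continuity predicts, namely 0.  Zeros of [b] are
    isolated ([ratfun_eval_neq0_near]), so near t, and except at t, the
    derivative of x - y is the right-hand side of the claim, which is
    continuous.  A function that is complex differentiable around t cannot have
    a derivative with a removable jump at t ([derivative_eq_punctured_limit]).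
    This could be read off from the analyticity of holomorphic functions, but
    the mean value theorem is enough: along the line t + s, s real, the
    derivative of Re F is Re F', and a real derivative that has a limit at a
    point takes that limit as its value there
    ([derivative_eq_punctured_limit_real]).  Applying this to F and to i F
    recovers both components of F'(t). *)

(** By the mean value theorem, the difference quotient at [a] with increment [h]
    is a value of the derivative strictly between [a] and [a + h], hence tends
    to [l] as [h] decreases to 0. *)
Lemma derivative_eq_punctured_limit_real (R : realType) (f df : R -> R)
    (a l : R) :
  (\forall x \near (a : R), is_derive (x : R) 1 f (df x)) ->
  df x @[x --> a^'] --> l -> df a = l.
Proof.
move=> fdf dfl.
pose q h := h^-1 *: (f (h + a) - f a).
have qdf : q h @[h --> 0^'+] --> df a.
  have [da <-] := nbhs_singleton fdf.
  apply: cvg_dnbhs_at_right; rewrite (_ : q = fun h =>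
    h^-1 *: ((f \o shift a) (h *: 1) - f a)) //.
  by apply/funext => h; rewrite /q /= [h%:A]mulr1.
suff ql : q h @[h --> 0^'+] --> l by exact: cvg_unique ql.
apply/cvgrPdist_lt => e e0.
have [d /= d0 dP] : \forall x \near (a : R), is_derive (x : R) 1 f (df x) /\
    (x != a -> `|l - df x| < e).
  have dfe : \forall x \near (a : R), x != a -> `|l - df x| < e.
    have /cvgrPdist_lt := dfl; exact.
  by near do split.
near=> h.
have h0 : 0 < h by near: h; exact: nbhs_right_gt.
have hd : h < d by near: h; exact: nbhs_right_lt.
have dc c : c \in `[a, h + a] -> ball a d c.
  rewrite in_itv /= => /andP[ac ch].
  rewrite /ball /= ltr_distlC; lra.
have ah : a < h + a by rewrite ltrDr.
have [c cin fE] : exists2 c, c \in `]a, h + a[ &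
    f (h + a) - f a = df c * (h + a - a).
  apply: MVT => // [c cin|].
    by apply: (dP _ (dc c _)).1; exact: subset_itv_oo_cc.
  apply: derivable_within_continuous => c cin.
  by have [[]] := dP _ (dc c cin).
rewrite /q fE addrK [_ *: _]mulrC mulfK ?gt_eqF //.
apply: (dP _ (dc c _)).2; first exact: subset_itv_oo_cc.
by move: cin; rewrite in_itv /= => /andP[ac _]; rewrite gt_eqF.
Unshelve. all: by end_near. Qed.

Lemma Re_continuous (R : realType) : continuous (@complex.Re R : Cplx R -> R).
Proof.
move=> z; apply/(@cvgrPdist_lt _ _ (Cplx R) (nbhs z) _) => e e0; near=> w.
rewrite -ltcR -raddfB; apply: le_lt_trans (normc_ge_Re _) _.
near: w.
have := @cvgr_dist_lt _ _ _ (nbhs z) _ id z _ e%:C%C; apply; last by rewrite ltcR.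
exact: cvg_id.
Unshelve. all: by end_near. Qed.

Lemma real_complex_continuous (R : realType) :
  continuous (real_complex R : R -> Cplx R).
Proof.
move=> x; apply/cvgrPdist_lt => e; rewrite /= ltcE /= => /andP[/eqP ie re0].
near=> y.
rewrite -raddfB /= normc_def /= expr0n addr0 sqrtr_sqr ltcE /= ie eqxx /=.
near: y. exact: cvgr_dist_lt.
Unshelve. all: by end_near. Qed.

Lemma continuous_horner_num {K : numFieldType} (p : {poly K}) :
  continuous (horner p).
Proof.
move=> t; elim/poly_ind: p => [|p c ihp].
  rewrite (_ : horner 0 = cst 0); first exact: cst_continuous.
  by apply/funext => s; rewrite horner0.
rewrite (_ : horner _ = fun s => p.[s] * s + c); last first.
  by apply/funext => s; rewrite hornerMXaddC.
exact: (cvgD (cvgM ihp cvg_id) (cvg_cst c)).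
Qed.

(** Dividing [p] by the highest power of [X - t] that divides it leaves a factor
    that is nonzero at [t], hence around [t] by continuity. *)
Lemma horner_neq0_near {K : numFieldType} (p : {poly K}) (t : K) :
  p != 0 -> \forall s \near t^', p.[s] != 0.
Proof.
move=> p0; have [m [q + pE]] := multiplicity_XsubC p t.
rewrite p0 /= => qt.
have qs : \forall s \near t, q.[s] != 0.
  exact: cvgr_neq0 (continuous_horner_num q t) qt.
near=> s; rewrite pE hornerM mulf_neq0 //.
  by near: s; exact: nbhs_dnbhs.
rewrite horner_exp hornerXsubC expf_neq0 // subr_eq0.
near: s; exact: nbhs_dnbhs_neq.
Unshelve. all: by end_near. Qed.

Lemma cvg_add_cst {K : numFieldType} {T} (F : set_system T) {FF : Filter F}
  (u : T -> K) (t : K) : u s @[s --> F] --> (0 : K) -> t + u s @[s --> F] --> t.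
Proof.
move=> u0; rewrite -[X in _ --> X]addr0.
by apply: cvgD => //; exact: cvg_cst.
Qed.

(** P + Q contains terms linear in the parameters, which the quartic does not,
    so this is a polynomial identity only once [a0] is eliminated with the
    normalization. *)
Lemma D4_PQ (K : comNzRingType) (eta a0 a1 a2 a3 a4 x y z : K) :
  a0 + a1 + 2 * a2 + a3 + a4 = 1 ->
  D4_P eta a0 a1 a2 a3 a4 x y z + D4_Q eta a0 a1 a2 a3 a4 x y z
    = (x - y) * (x - y + 1) * (x - y + 1 - eta) * (x - y - eta).
Proof.
move=> s; have -> :
    a0 = (a0 + a1 + 2 * a2 + a3 + a4) - a1 - 2 * a2 - a3 - a4 by ring.
rewrite s /D4_P /D4_Q; ring.
Qed.

Lemma cvg_scale (K : numFieldType) {T} (F : set_system T) {FF : Filter F}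
  (u : T -> K) (c l : K) : u s @[s --> F] --> l -> c * u s @[s --> F] --> c * l.
Proof. by move=> ul; apply: cvgM => //; exact: cvg_cst. Qed.

Lemma cvg_sub (K : numFieldType) {T} (F : set_system T) {FF : Filter F}
  (u v : T -> K) (k l : K) : u s @[s --> F] --> k -> v s @[s --> F] --> l ->
  u s - v s @[s --> F] --> k - l.
Proof. by move=> uk vl; exact: cvgB. Qed.

Section NumField.
Variable K : numFieldType.

Lemma ratfun_eval_continuous (b : {fraction {poly K}}) (t : K) :
  ~~ ratfun_pole b t -> ratfun_eval b s @[s --> t] --> ratfun_eval b t.
Proof.
move=> tb; rewrite /ratfun_eval.
have nc := continuous_horner_num (ratfun_num b) t.
have dc := continuous_horner_num (ratfun_den b) t.
exact: (cvgM nc (cvgV tb dc)).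
Qed.

Lemma ratfun_eval_neq0_near (b : {fraction {poly K}}) (t : K) :
  b != 0 -> \forall s \near t^', ratfun_eval b s != 0.
Proof.
move=> b0.
have n0 : ratfun_num b != 0.
  apply: contraNneq b0 => n0.
  by rewrite (ratfunE b) n0 tofrac0 mul0r.
have ns := horner_neq0_near _ t n0.
have ds := horner_neq0_near _ t (ratfun_den_neq0 b).
near=> s; rewrite mulf_neq0 // ?invr_eq0; near: s; [exact: ns|exact: ds].
Unshelve. all: by end_near. Qed.

Lemma is_derive_scale (F : K -> K) (c t l : K) :
  is_derive t 1 F l -> is_derive t 1 (fun s => c * F s) (c * l).
Proof. by move=> Fl; exact: is_deriveZ. Qed.

Lemma derivable_cvg (F : K -> K) (t : K) :
  derivable F t 1 -> F s @[s --> t] --> F t.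
Proof. by move=> /derivable1_diffP /differentiable_continuous. Qed.

Lemma is_derive_sub (F G : K -> K) (t : K) :
  derivable F t 1 -> derivable G t 1 ->
  is_derive t 1 (fun s => F s - G s) (derive1 F t - derive1 G t).
Proof.
by move=> /derivableP dF /derivableP dG; rewrite !derive1E; exact: is_deriveB.
Qed.

Lemma quartic_cvg {T} (F : set_system T) {FF : Filter F} (f u : T -> K)
    (c e k l : K) :
  f s @[s --> F] --> k -> u s @[s --> F] --> l ->
  f s / c * u s * (u s + 1) * (u s + 1 - e) * (u s - e) @[s --> F] -->
  k / c * l * (l + 1) * (l + 1 - e) * (l - e).
Proof.
move=> fk ul.
have cc (m : K) : cst m s @[s --> F] --> m by exact: cvg_cst.
have u1 : u s + 1 @[s --> F] --> l + 1 by exact: (cvgD ul (cc _)).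
have ue : u s - e @[s --> F] --> l - e by exact: (cvgB ul (cc _)).
have u1e : u s + 1 - e @[s --> F] --> l + 1 - e by exact: (cvgB u1 (cc _)).
have fc : f s / c @[s --> F] --> k / c by exact: (cvgM fk (cc _)).
exact: cvgM (cvgM (cvgM (cvgM fc ul) u1) u1e) ue.
Qed.

Lemma velocity_difference (e b dx dy P Q : K) : e != 0 -> b != 0 ->
  2 * e / b * dx = P -> - (2 * e / b) * dy = Q ->
  dx - dy = b / (2 * e) * (P + Q).
Proof. by move=> e0 b0 <- <-; field; rewrite e0 b0. Qed.

End NumField.

Section ComplexDerivative.
Variable R : realType.
Local Notation C := (Cplx R).

Lemma real_line_cvg (t : C) : t + s%:C%C @[s --> (0 : R)] --> t.
Proof.
apply: (@cvg_add_cst C R (nbhs (0:R)) _ (real_complex R) t).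
rewrite -(rmorph0 (real_complex R)).
exact: real_complex_continuous.
Qed.

Lemma real_line_dnbhs (t : C) :
  t + s%:C%C @[s --> (0 : R)^'] --> t^'.
Proof.
move=> A tA.
apply: (@filterS R (nbhs (0 : R)) _ _ _ _ (real_line_cvg t _ tA)) => s As s0.
apply: As.
by rewrite -subr_eq0 addrC addKr fmorph_eq0.
Qed.

(** The real difference quotient of Re F along the line is the real part of the
    complex difference quotient of F with a real increment. *)
Lemma is_derive_Re_real_line (F : C -> C) (t : C) (l : C) (s : R) :
  is_derive (t + s%:C%C) 1 F l ->
  is_derive s 1 (fun r : R => complex.Re (F (t + r%:C%C))) (complex.Re l).
Proof.
set f := fun r : R => _.
move=> [dF Fl].
have q : h^-1 * (F (h + (t + s%:C%C)) - F (t + s%:C%C)) @[h --> 0^'] --> l.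
  rewrite -Fl.
  rewrite (_ : (fun h => _) = fun h =>
    h^-1 *: ((F \o shift (t + s%:C%C)) (h *: 1) - F (t + s%:C%C))) //.
  by apply/funext => h /=; rewrite [h%:A]mulr1.
have qr := cvg_comp _ _ (cvg_comp _ _ (real_line_dnbhs 0) q) (@Re_continuous R l).
have fl : h^-1 *: ((f \o shift s) (h *: 1) - f s) @[h --> 0^'] --> complex.Re l.
  apply: cvg_trans qr; apply: near_eq_cvg; near=> h.
  rewrite /f /= [h%:A]mulr1 add0r -raddfB /= rmorphD /= (addrCA t) -fmorphV.
  by rewrite -complexr0; case: (_ - _) => x y; simpc.
split; first by apply: cvgP fl.
exact: cvg_lim fl.
Unshelve. all: by end_near. Qed.

Lemma Re_derivative_eq_punctured_limit (F dF : C -> C) (t l : C) :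
  (\forall s \near t, is_derive (s : C) 1 F (dF s)) ->
  dF s @[s --> t^'] --> l -> complex.Re (dF t) = complex.Re l.
Proof.
move=> FdF dFl.
have := @derivative_eq_punctured_limit_real R
  (fun r => complex.Re (F (t + r%:C%C))) (fun r => complex.Re (dF (t + r%:C%C)))
  0 (complex.Re l); rewrite addr0; apply.
  apply: (@filterS R (nbhs (0 : R)) _ _ _ _ (real_line_cvg t _ FdF)) => s.
  exact: is_derive_Re_real_line.
exact: (cvg_comp _ _ (cvg_comp _ _ (real_line_dnbhs t) dFl) (@Re_continuous R l)).
Qed.

(** The real part of [i * z] is minus the imaginary part of [z], so the equality
    of real parts, applied to [F] and to [i * F], gives both components. *)
Lemma derivative_eq_punctured_limit (F dF : C -> C) (t l : C) :
  (\forall s \near t, is_derive (s : C) 1 F (dF s)) ->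
  dF s @[s --> t^'] --> l -> dF t = l.
Proof.
move=> FdF dFl.
have re := Re_derivative_eq_punctured_limit _ _ _ _ FdF dFl.
have im : complex.Re ('i%C * dF t) = complex.Re ('i%C * l).
  apply: (Re_derivative_eq_punctured_limit
    (fun s => 'i%C * F s) (fun s => 'i%C * dF s)).
    by apply: filterS FdF => s; exact: is_derive_scale.
  exact: cvg_scale dFl.
move: re im; case: (dF t) => p q; case: l {dFl} => p' q'; simpc => /= -> /eqP.
by rewrite eqr_opp => /eqP ->.
Qed.

End ComplexDerivative.

Theorem proposition3p1 (R : realType) (eta : Cplx R)
    (b : {fraction {poly (Cplx R)}}) (a0 a1 a2 a3 a4 : Cplx R)
    (U : set (Cplx R)) (x y z : Cplx R -> Cplx R)
    (eta_neq0 : eta != 0) (b_neq0 : b != 0)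
    (sum_a : a0 + a1 + 2 * a2 + a3 + a4 = 1)
    (sol : D4_solution eta b a0 a1 a2 a3 a4 U x y z) :
  forall t : Cplx R, U t ->
    is_derive t 1 (fun s => x s - y s)
      (ratfun_eval b t / (2 * eta) * (x t - y t) * (x t - y t + 1)
         * (x t - y t + 1 - eta) * (x t - y t - eta)).
Proof.
move=> t Ut.
have [oU nopole dx dy _ ex ey _] := sol.
have dxy s (Us : U s) := is_derive_sub _ _ _ _ (dx s Us) (dy s Us).
pose G s := ratfun_eval b s / (2 * eta) * (x s - y s) * (x s - y s + 1)
         * (x s - y s + 1 - eta) * (x s - y s - eta).
have Gt : G s @[s --> t] --> G t.
  apply: (@quartic_cvg (Cplx R) (Cplx R) (nbhs t) _ (ratfun_eval b)
    (fun s => x s - y s)).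
    exact: ratfun_eval_continuous (nopole t Ut).
  by apply: cvg_sub; apply: derivable_cvg; [exact: dx|exact: dy].
have nU : \forall s \near t, U s by exact: open_nbhs_nbhs.
rewrite -/(G t) -(derivative_eq_punctured_limit _ (fun s => x s - y s)
  (fun s => derive1 x s - derive1 y s) t (G t)); first exact: dxy.
  by apply: filterS nU => s; exact: dxy.
(* The system determines x' - y' only off the zeros of [b], hence the punctured
   neighbourhood. *)
have dG : \forall s \near t^', G s = derive1 x s - derive1 y s.
  near=> s.
  have Us : U s by near: s; exact: nbhs_dnbhs nU.
  have bs : ratfun_eval b s != 0 by near: s; exact: ratfun_eval_neq0_near.
  rewrite (velocity_difference _ _ _ _ _ _ _ eta_neq0 bs
    (ex s Us bs) (ey s Us bs)).
  by rewrite (D4_PQ _ _ _ _ _ _ _ _ _ _ sum_a) /G !mulrA.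
have Gd : G s @[s --> t^'] --> G t by move=> A /Gt; exact: nbhs_dnbhs.
exact: cvg_trans (near_eq_cvg dG) Gd.
Unshelve. all: by end_near. Qed.
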